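(* Let $H$ be a separable Hilbert space, let $K\in\mathcal{B}(H)$, and let $F=\{f_j\}_{j=1}^{M}$ be a finite set of vectors in $H$ with $\Vert f_j\Vert=\Vert K\Vert$ for every $1\le j\le M$. Then there is a $K$-norm-frame for $H$ which contains the set $F$.
   Context: $\mathcal{B}(H)$ is the set of bounded linear operators on $H$. For $K\in\mathcal{B}(H)$, a sequence $\{g_j\}_{j\in\mathbb{J}}$ (with countable index set $\mathbb{J}$) of members of $H$ is a $K$-frame for $H$ if there exist constants $0<A\le B<\infty$ such that for each $f\in H$, $A\Vert K^*f\Vert^2\le\sum_{j\in\mathbb{J}}\vert\langle f,g_j\rangle\vert^2\le B\Vert f\Vert^2$. A $K$-norm-frame for $H$ is a $K$-frame $\{g_j\}_{j\in\mathbb{J}}$ for $H$ such that $\Vert g_j\Vert=\Vert K\Vert$ for every $j\in\mathbb{J}$. *)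

(* Defs.v *)
From HB Require Import structures.
From mathcomp Require Import all_boot all_order all_algebra.
From mathcomp Require Import sesquilinear complex.
From mathcomp Require Import all_classical all_reals all_analysis.

Set Implicit Arguments.
Unset Strict Implicit.
Unset Printing Implicit Defensive.

Import Order.TTheory GRing.Theory Num.Theory.
Import numFieldNormedType.Exports.

Local Open Scope classical_set_scope.
Local Open Scope ring_scope.

(* Hilbert spaces are taken over the real or over the complex numbers, in a
   uniform way: k selects the scalar field. *)
Variant scalar_kind := RealScalars | ComplexScalars.

Section scalars.
Variable R : realType.

Definition scalar (k : scalar_kind) : numFieldType :=
  match k with
  | RealScalars => R
  | ComplexScalars => R[i]
  end.

Definition sconj (k : scalar_kind) : involutive_rmorphism (scalar k) :=
  match k return involutive_rmorphism (scalar k) with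
  | RealScalars => (@idfun R : involutive_rmorphism R)
  | ComplexScalars => (@Num.conj R[i] : involutive_rmorphism R[i])
  end.

(* The norm of a normed module over R[i] takes its values in R[i]; the real part
   brings norms and moduli back to R. *)
Definition sRe (k : scalar_kind) : scalar k -> R :=
  match k return scalar k -> R with
  | RealScalars => fun x => x
  | ComplexScalars => fun z => complex.Re z
  end.

End scalars.

(* The inner product is linear in its first argument. *)
Record hilbertType (R : realType) (k : scalar_kind) := Hilbert {
  hilbert_sort :> completeNormedModType (scalar R k) ;
  inner : {dot hilbert_sort for @sconj R k} ;
  inner_norm : forall x : hilbert_sort, inner x x = `|x| ^+ 2
}.

Section hilbert.
Variables (R : realType) (k : scalar_kind) (H : hilbertType R k).

Definition rnorm (x : H) : R := sRe `|x|.

Definition separable : Prop := exists2 D : set H, countable D & dense D.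

(* For a linear map, boundedness near 0 is the existence of a constant r such
   that `|K x| <= r * `|x| for all x (linear_boundedP). *)
Definition bounded_operator (K : {linear H -> H}) : Prop :=
  bounded_near K (nbhs (0 : H)).

Definition opnorm (K : {linear H -> H}) : R :=
  sup [set rnorm (K x) | x in [set x : H | `|x| <= 1]].

(* When K is bounded, the vector z below exists by the Riesz representation
   theorem, and it is unique; the default value 0 is then irrelevant. *)
Definition adjoint (K : {linear H -> H}) (y : H) : H :=
  xget 0 [set z | forall x : H, inner H (K x) y = inner H x z].

Definition K_frame (K : {linear H -> H}) (J : countType) (g : J -> H) : Prop :=
  exists A B : R, [/\ 0 < A, A <= B &
    forall f : H,
      ((A * rnorm (adjoint K f) ^+ 2)%:E
         <= \esum_(j in [set: J]) (sRe `|inner H f (g j)| ^+ 2)%:E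
         <= (B * rnorm f ^+ 2)%:E)%E].

Definition K_norm_frame (K : {linear H -> H}) (J : countType) (g : J -> H)
    : Prop :=
  K_frame K g /\ forall j : J, rnorm (g j) = opnorm K.

End hilbert.

(* Main.v *)
(* Gram-Schmidt applied to a dense sequence gives a countable orthonormal basis
   (e_n), and g consists of the vectors f_j together with the vectors ||K|| e_n.
   By Parseval the frame sum of x is ||K||^2 ||x||^2 plus the contribution of
   the f_j. The first term dominates ||K^* x||^2, and by Cauchy-Schwarz the
   second one is at most M ||K||^2 ||x||^2. *)
From mathcomp Require Import all_boot all_order all_algebra.
From mathcomp Require Import sesquilinear complex.
From mathcomp Require Import all_classical all_reals all_analysis.
Require Import Defs.

Set Implicit Arguments.
Unset Strict Implicit.
Unset Printing Implicit Defensive.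

Import Order.TTheory GRing.Theory Num.Theory.
Import numFieldNormedType.Exports.

Local Open Scope classical_set_scope.
Local Open Scope ring_scope.

(** * Passing between the scalar field and the reals *)

Section scalar_theory.
Variables (R : realType) (k : scalar_kind).
Implicit Types x y : scalar R k.

Definition scalar_of_real : {rmorphism R -> scalar R k} :=
  match k return {rmorphism R -> scalar R k} with
  | RealScalars => (idfun : {rmorphism R -> R})
  | ComplexScalars => (real_complex R : {rmorphism R -> R[i]})
  end.

Lemma scalar_of_realK : cancel scalar_of_real (@sRe R k).
Proof. by rewrite /scalar_of_real; case: k. Qed.

Lemma ler_scalar_of_real : {mono scalar_of_real : r s / r <= s}.
Proof. by rewrite /scalar_of_real; case: k => //= r s; rewrite lecR. Qed.

(** In [R[i]], a number comparable with 0 from above is real, so it is recovered from its real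
    part. *)
Lemma sReK x : 0 <= x -> scalar_of_real (sRe x) = x.
Proof.
rewrite /scalar_of_real; case: k x => //= x x0.
exact/RRe_real/ger0_real.
Qed.

Lemma sReD x y : sRe (x + y) = sRe x + sRe y.
Proof. by case: k x y => // [] [? ?] [? ?]. Qed.

Lemma sRe_le x y : x <= y -> sRe x <= sRe y.
Proof. by case: k x y => //= x y; rewrite lecE => /andP[]. Qed.

Lemma sReM x y : 0 <= x -> 0 <= y -> sRe (x * y) = sRe x * sRe y.
Proof.
move=> x0 y0.
by rewrite -{1}(sReK x0) -{1}(sReK y0) -rmorphM scalar_of_realK.
Qed.

Lemma sRe0 : sRe (0 : scalar R k) = 0.
Proof. by rewrite -(rmorph0 scalar_of_real) scalar_of_realK. Qed.

Lemma sRe_ge0 x : 0 <= x -> 0 <= sRe x.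
Proof. by move/sRe_le; rewrite sRe0. Qed.

Lemma sRe_sum I (r : seq I) (P : pred I) (F : I -> scalar R k) :
  sRe (\sum_(i <- r | P i) F i) = \sum_(i <- r | P i) sRe (F i).
Proof. exact: (big_morph _ sReD sRe0). Qed.

Lemma sReX x n : 0 <= x -> sRe (x ^+ n) = sRe x ^+ n.
Proof.
by move=> x0; rewrite -{1}(sReK x0) -rmorphXn scalar_of_realK.
Qed.

Lemma mul_sconj x : x * sconj R k x = `|x| ^+ 2.
Proof.
case: k x => /= x; first by rewrite real_normK ?num_real// expr2.
by rewrite normCK.
Qed.

Lemma norm_sconj x : `|sconj R k x| = `|x|.
Proof. by case: k x => //= x; rewrite norm_conjC. Qed.

Lemma norm_scalar_of_real r : 0 <= r -> `|scalar_of_real r| = scalar_of_real r.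
Proof.
by move=> r0; rewrite ger0_norm// -(rmorph0 scalar_of_real) ler_scalar_of_real.
Qed.

End scalar_theory.
Arguments scalar_of_real {R} k.
Arguments scalar_of_realK {R} k.

(** * Orthogonal projection, Cauchy-Schwarz and Gram-Schmidt *)

Section inner_product.
Variables (R : realType) (k : scalar_kind) (H : hilbertType R k).
Implicit Types x y e : H.

Lemma innerC x y : inner H x y = sconj R k (inner H y x).
Proof. by rewrite hermC expr0 mul1r. Qed.

Lemma innerZr a x y : inner H x (a *: y) = sconj R k a * inner H x y.
Proof. exact: linearZr_LR. Qed.

Lemma innerZl a x y : inner H (a *: x) y = a * inner H x y.
Proof. exact: linearZl_LR. Qed.

Lemma inner0r x : inner H x 0 = 0. Proof. exact: linear0r. Qed.
Lemma inner0l x : inner H 0 x = 0. Proof. exact: linear0l. Qed.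

Definition normalize x : H := `|x|^-1 *: x.

(** The component of [x] orthogonal to [e], when [e] is a unit vector or 0. *)
Definition reject e x : H := x - inner H x e *: e.

Lemma normalize0 : normalize 0 = 0.
Proof. by rewrite /normalize scaler0. Qed.

Lemma norm_normalize x : x != 0 -> `|normalize x| = 1.
Proof.
by move=> x0; rewrite normrZ normfV normr_id mulVf// normr_eq0.
Qed.

Lemma inner_normalize x : inner H x (normalize x) = `|x|.
Proof.
have [->|x0] := eqVneq x 0; first by rewrite inner0l normr0.
rewrite innerZr inner_norm fmorphV/= expr2 mulrA.
(* Cancelling the nonzero norm in [mul_sconj] shows it self-conjugate over either field. *)
have -> : sconj R k `|x| = `|x|.
  apply: (mulfI (x := `|x|)); first by rewrite normr_eq0.
  by rewrite mul_sconj normr_id expr2.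
by rewrite mulVf ?mul1r// normr_eq0.
Qed.

Lemma reject_normalize x : reject (normalize x) x = 0.
Proof.
rewrite /reject inner_normalize /normalize.
have [->|x0] := eqVneq x 0; first by rewrite !scaler0 subrr.
by rewrite scalerA divff ?scale1r ?subrr// normr_eq0.
Qed.

Lemma inner_reject x e : inner H (reject (normalize e) x) (normalize e) = 0.
Proof.
rewrite linearBl/= innerZl inner_norm.
have [->|e0] := eqVneq e 0; first by rewrite normalize0 inner0r mul0r subrr.
by rewrite norm_normalize// expr1n mulr1 subrr.
Qed.

(** Pythagoras; if [e] is 0 then so is [normalize e], and nothing is subtracted. *)
Lemma norm_reject x e :
  `|x| ^+ 2 = `|reject (normalize e) x| ^+ 2 + `|inner H x (normalize e)| ^+ 2.
Proof.
set u := normalize e.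
have ->: `|inner H x u| ^+ 2 = `|inner H x u *: u| ^+ 2.
  have [e0|e0] := eqVneq e 0.
    by rewrite /u e0 normalize0 inner0r scaler0 !normr0.
  by rewrite normrZ norm_normalize// mulr1.
rewrite -!inner_norm -hnormDd ?subrK//.
by rewrite [LHS]innerZr inner_reject mulr0.
Qed.

Lemma inner_CauchySchwarz x y : `|inner H x y| <= `|x| * `|y|.
Proof.
have [->|y0] := eqVneq y 0; first by rewrite inner0r !normr0 mulr0.
(* Drop the rejected component from Pythagoras, then rescale by the norm of [y]. *)
have : `|inner H x (normalize y)| <= `|x|.
  rewrite -(@ler_pXn2r _ 2) ?nnegrE//.
  by rewrite (norm_reject x y) lerDr exprn_ge0.
rewrite innerZr normrM norm_sconj normfV normr_id mulrC ler_pdivrMr//.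
by rewrite normr_gt0.
Qed.

Variable d : nat -> H.

(* residual n x is x minus its projection on the span of the d i, i < n. *)
Fixpoint residual n : H -> H :=
  if n is m.+1 then
    fun x => reject (normalize (residual m (d m))) (residual m x)
  else id.

(* gram_schmidt n = 0 when d n depends linearly on its predecessors. *)
Definition gram_schmidt n : H := normalize (residual n (d n)).

Local Notation Q := residual.
Local Notation e := gram_schmidt.

Lemma residualB n : {morph Q n : x y / x - y}.
Proof.
elim: n => //= n IH x y; rewrite IH /reject linearBl/= scalerBl.
by rewrite !opprD !opprK addrACA.
Qed.

(** The last projection removes the direction [e n]; it preserves the earlier orthogonality because
    [e n] is itself a multiple of a residual. *)
Lemma inner_residual_gram_schmidt x n i : (i < n)%N ->
  inner H (Q n x) (e i) = 0.
Proof.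
elim: n x => // n IH x; rewrite ltnS leq_eqVlt => /predU1P[->|ni].
  exact: inner_reject.
rewrite /= /reject linearBl/= IH// innerZl [normalize _]/(_ *: _) innerZl IH//.
by rewrite !mulr0 subr0.
Qed.

Lemma inner_gram_schmidt n i : (i < n)%N -> inner H (e n) (e i) = 0.
Proof. by move=> ni; rewrite innerZl inner_residual_gram_schmidt// mulr0. Qed.

Lemma inner_residualE x n m : (n <= m)%N ->
  inner H (Q n x) (e m) = inner H x (e m).
Proof.
elim: n => // n IH nm; rewrite /= /reject linearBl/= IH ?(ltnW nm)//.
rewrite innerZl -/(e n) [inner H (e n) _]innerC inner_gram_schmidt//.
by rewrite rmorph0 mulr0 subr0.
Qed.

(** Pythagoras at each projection; the coefficient of the residual along [e n] equals that of [x] by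
    [inner_residualE]. This yields Bessel's inequality with its exact defect. *)
Lemma norm_residual x n :
  `|x| ^+ 2 = `|Q n x| ^+ 2 + \sum_(i < n) `|inner H x (e i)| ^+ 2.
Proof.
elim: n => [|n ->]; first by rewrite big_ord0 addr0.
rewrite (norm_reject (Q n x) (Q n (d n))) big_ord_recr/= -/(e n).
by rewrite inner_residualE// -addrA [_ ^+ 2 + \sum_(i < n) _]addrC.
Qed.

Lemma residual_le x n : `|Q n x| <= `|x|.
Proof.
rewrite -(@ler_pXn2r _ 2) ?nnegrE// (norm_residual x n) lerDl.
by apply: sumr_ge0 => i _; rewrite exprn_ge0.
Qed.

Lemma residual_id n : Q n.+1 (d n) = 0.
Proof. exact: reject_normalize. Qed.

Lemma norm_gram_schmidt n : e n != 0 -> `|e n| = 1.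
Proof.
rewrite /e; have [->|?] := eqVneq (Q n (d n)) 0.
  by rewrite normalize0 eqxx.
by move=> _; exact: norm_normalize.
Qed.

End inner_product.

(** * Unordered sums over finite, disjoint-union and subset index types *)

Section esum_types.
Variable R : realType.

Lemma esum_finType (T : finType) (a : T -> \bar R) :
  (forall i, 0 <= a i)%E -> (\esum_(i in [set: T]) a i = \sum_i a i)%E.
Proof.
move=> a0; rewrite esum_fset//; last exact: finite_finset.
 rewrite (fsbigE (index_enum T)) ?index_enum_uniq//=.
  by apply: eq_bigl => i; rewrite in_setT.
by move=> i _; rewrite mem_index_enum.
Qed.

Lemma esum_sum_type (I J : choiceType) (a : I + J -> \bar R) :
  (forall u, 0 <= a u)%E ->
  (\esum_(u in [set: (I + J)%type]) a u =
   \esum_(i in [set: I]) a (inl i) + \esum_(j in [set: J]) a (inr j))%E.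
Proof.
move=> a0; rewrite (esumID (range inl))// !setTI; congr (_ + _)%E.
  by rewrite esum_image//; apply: in2W => x y [].
rewrite -(@esum_image _ _ _ setT inr); last by apply: in2W => x y [].
congr (\esum_(i in _) _)%E; apply/seteqP; split=> [[i|j]|[i|j]] //=.
- by case; exists i.
- by move=> _; exists j.
- by case.
- by move=> _ [].
Qed.

Lemma esum_sig (T : countType) (P : pred T) (a : T -> \bar R) :
  (forall i, ~~ P i -> a i = 0)%E ->
  (\esum_(u in [set: {i : T | P i}]) a (val u) = \esum_(i in [set: T]) a i)%E.
Proof.
move=> a0; rewrite -(@esum_image _ _ _ setT val); last first.
  by apply: in2W; exact: val_inj.
rewrite esum_mkcond; apply: eq_esum => i _; case: ifPn => //.
rewrite notin_setE => Pi; rewrite a0//; apply/negP => p.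
by apply: Pi; exists (exist _ i p).
Qed.

End esum_types.

(** * Parseval's identity and bounds for the operator and its adjoint *)

Section hilbert_theory.
Variables (R : realType) (k : scalar_kind) (H : hilbertType R k).
Implicit Types x y : H.

Lemma rnorm_ge0 x : 0 <= rnorm x.
Proof. exact: sRe_ge0. Qed.

Lemma rnorm0 : rnorm (0 : H) = 0.
Proof. by rewrite /rnorm normr0 sRe0. Qed.

Lemma rnormZ a x : rnorm (a *: x) = sRe `|a| * rnorm x.
Proof. by rewrite /rnorm normrZ sReM. Qed.

Lemma rnorm_CauchySchwarz x y : sRe `|inner H x y| <= rnorm x * rnorm y.
Proof.
by rewrite /rnorm -sReM//; apply: sRe_le; exact: inner_CauchySchwarz.
Qed.

Lemma dense_sequence : separable H ->
  exists d : nat -> H, forall x (eps : scalar R k),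
    0 < eps -> exists n, `|x - d n| < eps.
Proof.
move=> [D /countable_injP[g gI] denseD].
(* [d] inverts the injection [g] on [D]; codes that are not attained give the harmless value 0. *)
pose d n := xget 0 [set x | D x /\ g x = n]; exists d => x eps eps0.
have [|y [yx Dy]] := denseD (ball x eps) _ (ball_open x eps).
  by exists x; exact: ballxx.
exists (g y); suff -> : d (g y) = y by move: yx; rewrite -ball_normE.
rewrite /d; case: xgetP => [z _ [Dz gzy]|/(_ y)]; last by case.
by apply: gI; rewrite ?inE.
Qed.

(** Partial sums fall short of the squared norm by a squared residual, which density makes
    arbitrarily small. Vanishing [e n] contribute nothing. *)
Lemma parseval (d : nat -> H) (e := gram_schmidt d) :
  (forall x (eps : scalar R k), 0 < eps -> exists n, `|x - d n| < eps) ->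
  forall x, (\esum_(n in [set: nat]) (sRe `|inner H x (e n)| ^+ 2)%:E =
    (rnorm x ^+ 2)%:E)%E.
Proof.
move=> dense_d x.
have rnormE n : rnorm x ^+ 2 = rnorm (residual d n x) ^+ 2 +
    \sum_(i < n) sRe `|inner H x (e i)| ^+ 2.
  rewrite -sReX// (norm_residual d x n) sReD sReX// sRe_sum.
  by congr (_ + _); apply: eq_bigr => i _; rewrite sReX.
have a0 n : (0 <= (sRe `|inner H x (e n)| ^+ 2)%:E)%E.
  by rewrite lee_fin sqr_ge0.
rewrite -nneseries_esumT//; apply/eqP; rewrite eq_le; apply/andP; split.
  apply: lime_le; first exact: is_cvg_nneseries.
  apply: nearW => n; rewrite sumEFin lee_fin big_mkord (rnormE n).
  by rewrite lerDr sqr_ge0.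
apply/lee_addgt0Pr => eps eps0.
pose r := scalar_of_real k (Num.sqrt eps).
have [|n xd] := dense_d x r.
  rewrite lt_def -(rmorph0 (scalar_of_real k)) ler_scalar_of_real sqrtr_ge0.
  by rewrite (can_eq (scalar_of_realK k)) sqrtr_eq0 -ltNge eps0.
apply: (@le_trans _ _ (\sum_(0 <= i < n.+1)
    (sRe `|inner H x (e i)| ^+ 2)%:E + eps%:E)%E); last first.
  by rewrite leeD2r//; exact: nneseries_lim_ge.
rewrite sumEFin -EFinD lee_fin big_mkord (rnormE n.+1) addrC lerD2l.
rewrite -(sqr_sqrtr (ltW eps0)) ler_pXn2r ?nnegrE ?rnorm_ge0 ?sqrtr_ge0//.
rewrite -[leRHS](scalar_of_realK k); apply: sRe_le.
(* The residual of index [n.+1] kills [d n], so at [x] and at [x - d n] it agrees, and it does not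
   increase norms. *)
apply: le_trans (ltW xd); apply: le_trans (residual_le d _ n.+1).
by rewrite residualB residual_id subr0.
Qed.

Variable K : {linear H -> H}.

Lemma opnorm_has_ubound : bounded_operator K ->
  has_ubound [set rnorm (K x) | x in [set x : H | `|x| <= 1]].
Proof.
move=> /linear_boundedP/pinfty_ex_gt0[r r0 Kr].
exists (sRe r) => _ [x /= x1 <-].
by apply: sRe_le; rewrite (le_trans (Kr x))// ler_piMr// ltW.
Qed.

Hypothesis bK : bounded_operator K.

Lemma opnorm_ge0 : 0 <= opnorm K.
Proof.
apply: (le_trans (rnorm_ge0 (K 0))); apply: ub_le_sup.
  exact: opnorm_has_ubound.
by exists 0 => //=; rewrite normr0.
Qed.

Lemma opnorm_le x : rnorm (K x) <= opnorm K * rnorm x.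
Proof.
have [->|x0] := eqVneq x 0; first by rewrite linear0 rnorm0 mulr0.
(* Homogeneity reduces the bound to a unit vector, where the supremum applies. *)
have -> : K x = `|x| *: K (normalize x).
  by rewrite linearZ/= scalerA divff ?scale1r// normr_eq0.
rewrite rnormZ normr_id mulrC ler_wpM2r// ?rnorm_ge0//.
apply: ub_le_sup; first exact: opnorm_has_ubound.
by exists (normalize x) => //=; rewrite norm_normalize.
Qed.

(* No appeal to Riesz is needed: the junk value 0 of adjoint obeys the bound. *)
Lemma rnorm_adjoint_le y : rnorm (adjoint K y) <= opnorm K * rnorm y.
Proof.
rewrite /adjoint; case: xgetP => [z _ adjK|_]; last first.
  by rewrite rnorm0 mulr_ge0// ?rnorm_ge0// opnorm_ge0.
have [->|z0] := eqVneq (rnorm z) 0.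
  by rewrite mulr_ge0// ?rnorm_ge0// opnorm_ge0.
(* With [z] the adjoint value, multiply by its norm: the square of that norm is the inner product of
   [K z] and [y], to which Cauchy-Schwarz applies. *)
rewrite -(@ler_pM2l _ (rnorm z)) ?lt_def ?z0 ?rnorm_ge0//.
have -> : rnorm z * rnorm z = sRe `|inner H (K z) y|.
  by rewrite adjK inner_norm normrX normr_id sReX// expr2.
apply: (le_trans (rnorm_CauchySchwarz _ _)).
by rewrite mulrCA mulrA ler_wpM2r ?rnorm_ge0// opnorm_le.
Qed.

End hilbert_theory.

Theorem theorem3p1 (R : realType) (k : scalar_kind) (H : hilbertType R k)
    (sepH : separable H) (K : {linear H -> H}) (bK : bounded_operator K)
    (M : nat) (f : 'I_M -> H) (fK : forall j : 'I_M, rnorm (f j) = opnorm K) :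
  exists (J : countType) (g : J -> H),
    K_norm_frame K g /\ range f `<=` range g.
Proof.
have [d dense_d] := dense_sequence sepH.
pose e := gram_schmidt d; pose c := opnorm K.
have c0 : 0 <= c := opnorm_ge0 bK.
pose s := scalar_of_real k c.
have ns : sRe `|s| = c by rewrite norm_scalar_of_real// scalar_of_realK.
(* Zero vectors of Gram-Schmidt are left out, since every frame vector must have norm [opnorm K]. *)
pose J : countType := ('I_M + {n : nat | e n != 0})%type.
pose g (j : J) := match j with inl i => f i | inr n => s *: e (val n) end.
exists J, g; split; last by move=> _ [i _ <-]; exists (inl i).
split; last first.
  case=> [i|[n en]] /=; first exact: fK.
  rewrite rnormZ ns /rnorm norm_gram_schmidt//.
  by rewrite -(rmorph1 (scalar_of_real k)) scalar_of_realK mulr1.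
(* The maximum with 1 keeps the upper constant above the lower one even when [c] is small or
   zero. *)
exists 1, (Num.max 1 (M%:R * c ^+ 2 + c ^+ 2)).
split=> [//||x]; first by rewrite le_max lexx.
have sq0 (j : J) : (0 <= (sRe `|inner H x (g j)| ^+ 2)%:E)%E.
  by rewrite lee_fin sqr_ge0.
rewrite esum_sum_type//= esum_finType//; last by move=> i; exact: (sq0 (inl i)).
(* Restore the omitted indices, whose terms vanish, so that Parseval applies over all of [nat]. *)
rewrite (esum_sig (P := fun n => e n != 0)
  (a := fun n => (sRe `|inner H x (s *: e n)| ^+ 2)%:E)); last first.
  by move=> n /negPn/eqP ->; rewrite scaler0 inner0r normr0 sRe0 expr0n.
(* Moving [s] to the other argument only conjugates it; Parseval for [s *: x] then supplies the
   factor [c ^+ 2]. *)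
rewrite (@eq_esum _ _ _ _ (fun n => (sRe `|inner H (s *: x) (e n)| ^+ 2)%:E)).
  rewrite parseval// rnormZ ns exprMn sumEFin -EFinD !lee_fin.
  apply/andP; split.
    rewrite mul1r -exprMn -[leLHS]add0r lerD//.
      by apply: sumr_ge0 => i _; exact: sqr_ge0.
    rewrite ler_pXn2r ?nnegrE ?mulr_ge0 ?rnorm_ge0//.
    exact: rnorm_adjoint_le.
  apply: (@le_trans _ _ ((M%:R * c ^+ 2 + c ^+ 2) * rnorm x ^+ 2)).
    rewrite mulrDl lerD2r -mulrA mulr_natl -[in leRHS](card_ord M) -sumr_const.
    apply: ler_sum => i _.
    rewrite -exprMn ler_pXn2r ?nnegrE ?mulr_ge0 ?rnorm_ge0 ?sRe_ge0//.
    by rewrite mulrC /c -(fK i) rnorm_CauchySchwarz.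
  by rewrite ler_wpM2r ?sqr_ge0// le_max lexx orbT.
by move=> n _; rewrite innerZr innerZl !normrM norm_sconj.
Qed.
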